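(* For every integer $m\ge1$, the Binet polynomial $b_m(\alpha)$ is a polynomial of degree $m-1$ in $\alpha$, $$b_m(\alpha)=\sum_{j=0}^{m-1}p_j(m)\,\alpha^j,$$ with coefficients, for $0\le j\le m-1$, $$p_j(m)=\frac1{j!}\left.\frac{d^jb_m(\alpha)}{d\alpha^j}\right|_{\alpha=0}=\frac{(-1)^{m-1-j}}{2m\,j!}\sum_{k=j+1}^{m}\frac{k!\,(k-j)}{(k+2-j)!}S_m^{(k)} .$$ In particular $p_{m-1}(m)=\frac1{12}$ and, for $m\ge2$, $p_{m-2}(m)=\frac1{12}\binom{m-1}{2}$. Moreover $$p_j(m)=\frac1{m\,j!}\int_{-1}^{0}\left(u+\tfrac12\right)\frac{d^j}{du^j}\left(\prod_{k=0}^{m-1}(k+u)\right)du .$$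
   Context: $S_m^{(k)}$ denotes the (signed) Stirling number of the first kind, defined by $\prod_{k=0}^{m-1}(x-k)=\sum_{k=0}^{m}S_m^{(k)}x^k$. For $m\ge1$ the Binet polynomial is $$b_m(\alpha)=\frac1m\sum_{k=1}^{m}\left\{\frac{\alpha^{k+2}-(\alpha-1)^{k+2}}{k+2}+\frac{\left(\frac12-\alpha\right)\left(\alpha^{k+1}-(\alpha-1)^{k+1}\right)}{k+1}\right\}(-1)^{k-m}S_m^{(k)},$$ equivalently $b_m(\alpha)=\frac1m\int_{\alpha-1}^{\alpha}\left(x+\frac12-\alpha\right)\prod_{k=0}^{m-1}(k+x)\,dx$. *)

(* Defs.v *)
From mathcomp Require Import all_boot all_order all_algebra.
From mathcomp Require Import all_classical all_reals all_analysis.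

Set Implicit Arguments.
Unset Strict Implicit.
Unset Printing Implicit Defensive.

Import Order.TTheory GRing.Theory Num.Theory.
Import numFieldNormedType.Exports.

Local Open Scope ring_scope.

(* Signed Stirling number of the first kind S_m^(k), from its generating
   polynomial x (x - 1) ... (x - (m - 1)). *)
Definition stirling1 (m k : nat) : int :=
  (\prod_(i < m) ('X - (i%:Z)%:P))`_k.

(* The exponent k - m is a nonpositive integer, hence the integer power. *)
Definition binet (R : realType) (m : nat) (alpha : R) : R :=
  m%:R^-1 * \sum_(1 <= k < m.+1)
    (((alpha ^+ k.+2 - (alpha - 1) ^+ k.+2) / k.+2%:R
      + (1 / 2 - alpha) * (alpha ^+ k.+1 - (alpha - 1) ^+ k.+1) / k.+1%:R)
     * (-1) ^ (k%:Z - m%:Z) * (stirling1 m k)%:~R).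

(* Main.v *)
From HB Require Import structures.
Require Import Defs.
From mathcomp Require Import all_boot all_order all_algebra.
From mathcomp Require Import all_classical all_reals all_analysis.
From mathcomp Require Import zify ring.

(** Writing [L f] for the integral of [(u + 1/2) f(u)] over [-1, 0] and [q] for
    the rising factorial [u (u + 1) ... (u + m - 1)], a translation of the
    variable gives [b_m(alpha) = L (q(X + alpha)) / m]. By Taylor's formula the
    coefficient of [alpha^j] is then [L (q^(j)) / (m j!)], and evaluating [L] on
    monomials gives the closed form. Since [L 1 = 0], the degree is below [m]. *)

Set Implicit Arguments.
Unset Strict Implicit.
Unset Printing Implicit Defensive.

Import Order.TTheory GRing.Theory Num.Theory.
Import numFieldNormedType.Exports.

Local Open Scope ring_scope.

(** * The weighted integral over [-1, 0] as a linear form on polynomials *)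

Section Moment.
Variable R : numFieldType.
Implicit Types (f F : {poly R}) (a b : R).

(* The constant coefficient is [f`_0 / 0 = 0]. *)
Definition antideriv f : {poly R} :=
  \poly_(i < (size f).+1) (f`_i.-1 / i%:R).

Lemma coef_antideriv f i : (antideriv f)`_i = f`_i.-1 / i%:R.
Proof.
rewrite coef_poly; case: ltnP => //; case: i => [//|i] /= hi.
by rewrite nth_default ?mul0r.
Qed.

Lemma deriv_antideriv f : (antideriv f)^`() = f.
Proof.
apply/polyP => i; rewrite coef_deriv coef_antideriv /=.
by rewrite -mulrnAr -[X in _ * X]mulr_natr mulVf ?mulr1 // pnatr_eq0.
Qed.

Lemma antiderivK F : antideriv F^`() = F - (F`_0)%:P.
Proof.
apply/polyP => -[|i]; rewrite coef_antideriv coefB coefC /=.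
  by rewrite invr0 mulr0 subrr.
by rewrite coef_deriv subr0 -[X in X / _]mulr_natr mulfK ?pnatr_eq0.
Qed.

Lemma antideriv_is_linear : linear antideriv.
Proof.
move=> a f g; apply/polyP => i.
by rewrite coefD coefZ !coef_antideriv coefD coefZ mulrDl mulrA.
Qed.

(* The integral of [(u + 1/2) f(u)] over [-1, 0]. *)
Definition moment f : R :=
  let F := antideriv (('X + (2^-1)%:P) * f) in F.[0] - F.[-1].

Lemma moment_is_scalar : scalar moment.
Proof.
move=> a f g; rewrite /moment mulrDr -scalerAr antideriv_is_linear.
by rewrite !hornerD !hornerZ opprD addrACA -mulrBr.
Qed.

HB.instance Definition _ :=
  GRing.isLinear.Build R {poly R} R _ moment moment_is_scalar.

(** Two primitives differ by a constant, which cancels between the endpoints. *)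
Lemma moment_deriv f F :
  F^`() = ('X + (2^-1)%:P) * f -> moment f = F.[0] - F.[-1].
Proof. by move=> eF; rewrite /moment -eF antiderivK !hornerD !hornerN !hornerC; ring. Qed.

(** With t = X + a the weight X + 1/2 is t + (1/2 - a), so t^(k+1) + (1/2 - a) t^k is integrated
    from t = a - 1 to t = a. This produces the bracket in the definition of [binet]. *)
Lemma moment_XaddC_exp (a : R) k :
  moment (('X + a%:P) ^+ k) =
    (a ^+ k.+2 - (a - 1) ^+ k.+2) / k.+2%:R
    + (1 / 2 - a) * (a ^+ k.+1 - (a - 1) ^+ k.+1) / k.+1%:R.
Proof.
rewrite (@moment_deriv _ (k.+2%:R^-1 *: ('X + a%:P) ^+ k.+2
   + ((1 / 2 - a) / k.+1%:R) *: ('X + a%:P) ^+ k.+1)).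
  rewrite !(hornerD, hornerZ, horner_exp, hornerX, hornerC) add0r [-1 + a]addrC.
  by rewrite opprD addrACA -!mulrBr mulrC [_ / _ * _]mulrAC.
have scaleK n (c : R) (p : {poly R}) : (c / n.+1%:R) *: (p *+ n.+1) = c *: p.
  by rewrite -scalerMnr scalerMnl -[X in X *: _]mulr_natr divfK ?pnatr_eq0.
rewrite derivD !derivZ !deriv_exp derivD derivX derivC addr0 !mul1r /=.
rewrite -[k.+2%:R^-1]mul1r !scaleK scale1r exprS -mul_polyC -mulrDl.
by rewrite polyCB addrACA subrr addr0.
Qed.

(** The case a = 0 of the previous lemma. The factor k makes the moment of 1 vanish, and this
    removes the lowest term of several sums below. *)
Lemma moment_Xn k :
  moment 'X^k = (-1) ^+ k.+1 * k%:R / (2 * k.+1%:R * k.+2%:R).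
Proof.
rewrite -['X]addr0 -polyC0 moment_XaddC_exp !expr0n /= !sub0r subr0.
rewrite !exprS; field.
by rewrite -[1]/(1%:R) -!natrD !pnatr_eq0.
Qed.

Lemma moment_sum n f : (size f <= n)%N ->
  moment f = \sum_(i < n) f`_i * moment 'X^i.
Proof.
move=> hf; have {1}-> : f = \sum_(i < n) f`_i *: 'X^i.
  rewrite -poly_def; apply/polyP => i; rewrite coef_poly.
  by case: ltnP => // ni; rewrite nth_default // (leq_trans hf).
by rewrite linear_sum; apply: eq_bigr => i _; rewrite linearZ.
Qed.

End Moment.

(** Composition is evaluation of the lifted polynomial [q^:P] at X + a, so Taylor's formula applies
    over the ring of polynomials. *)
Lemma comp_XaddC_taylor (R : comNzRingType) (q : {poly R}) (a : R) :
  q \Po ('X + a%:P) = \sum_(i < size q) a ^+ i *: q^`N(i).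
Proof.
rewrite /comp_poly nderiv_taylor; last exact: mulrC.
have -> : size (q^:P) = size q by rewrite size_map_inj_poly //; exact: polyC_inj.
apply: eq_bigr => i _; rewrite nderivn_map -rmorphXn mulrC mul_polyC.
by rewrite [(_^:P).['X]]comp_polyXr.
Qed.

(** * Rising factorials and Stirling numbers of the first kind *)

Section RisingFactorial.
Variable R : nzRingType.

Definition rising m : {poly R} := \prod_(i < m) ('X + (i%:R)%:P).

Lemma size_rising m : size (rising m) = m.+1.
Proof.
rewrite /rising; under eq_bigr do rewrite -[(_%:R)%:P]opprK -polyCN.
by rewrite size_prod_XsubC /index_enum -enumT size_enum_ord.
Qed.

(** Replacing X by -X turns the falling factorial into the rising one up to (-1)^m; the induction
    compares the recurrences given by the last factor. The exponent m + k has the parity of m - k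
    and avoids truncated subtraction. *)
Lemma coef_rising m k :
  (rising m)`_k = (-1) ^+ (m + k) * (stirling1 m k)%:~R.
Proof.
elim: m k => [|m IH] k; rewrite /rising /stirling1.
  by rewrite !big_ord0 !coef1; case: k => [|k]; rewrite ?mulr1 ?mulr0.
rewrite !big_ord_recr /= mulrDr coefD coefMX coefMC mulrBr coefB coefMX coefMC.
rewrite -/(rising m) -/(stirling1 m k).
case: k => [|k] /=; rewrite !IH rmorphB rmorphM /= -pmulrn.
  by rewrite !add0r !addn0 exprS mulN1r mulrN mulNr opprK mulrA.
rewrite !addSn !addnS !exprS !mulN1r opprK mulrBr.
by rewrite !mulNr mulrA.
Qed.

End RisingFactorial.

Lemma stirling1_diag m : stirling1 m m = 1.
Proof.
have := lead_coef_prod_XsubC (index_enum 'I_m) xpredT (fun i : 'I_m => i%:Z).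
by rewrite lead_coefE size_prod_XsubC -[X in size X]enumT size_enum_ord; exact.
Qed.

(** By Vieta, this is minus the sum 0 + 1 + ... + m of the roots. *)
Lemma stirling1_subdiag m : stirling1 m.+1 m = - ('C(m.+1, 2))%:Z.
Proof.
have := @coefPn_prod_XsubC int [seq (val i)%:Z | i <- index_enum 'I_m.+1].
rewrite size_map -[X in size X]enumT size_enum_ord !big_map => /(_ isT) /= E.
rewrite /stirling1 E -bin2_sum big_mkord.
by rewrite (big_morph Posz PoszD (erefl _)).
Qed.

(** * Integrals, derivatives and the coefficients of the Binet polynomial *)

Section Analysis.
Variable R : realType.

Lemma derive1n_horner (p : {poly R}) j :
  derive1n j (horner p) = horner p^`(j).
Proof. by elim: j => [//|j IH]; rewrite derive1nS IH derivnS derivE. Qed.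

Lemma Rintegral_horner_deriv (F : {poly R}) (a b : R) : a < b ->
  \int[@lebesgue_measure R]_(u in `[a, b]%classic) F^`().[u] = F.[b] - F.[a].
Proof.
move=> ab; rewrite /Rintegral (@continuous_FTC2 _ (horner F^`()) (horner F)) //.
- by apply: continuous_subspaceT => x; exact: continuous_horner.
- split=> [x _||].
  + exact: derivable_horner.
  + by apply: cvg_at_right_filter; exact: continuous_horner.
  + by apply: cvg_at_left_filter; exact: continuous_horner.
- by move=> x _; rewrite derivE.
Qed.

Lemma Rintegral_moment (f : {poly R}) :
  \int[@lebesgue_measure R]_(u in `[(-1 : R), (0 : R)]%classic)
    ((u + 1 / 2) * f.[u]) = moment f.
Proof.
rewrite /moment -Rintegral_horner_deriv ?ltrN10 // deriv_antideriv.
by apply: eq_Rintegral => u _; rewrite !hornerE.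
Qed.

Lemma binet_moment m (a : R) : (0 < m)%N ->
  binet m a = m%:R^-1 * moment (rising R m \Po ('X + a%:P)).
Proof.
move=> m0; rewrite /binet comp_polyE size_rising linear_sum; congr (_ * _).
rewrite -(big_mkord xpredT (fun k => moment ((rising R m)`_k *: ('X + a%:P) ^+ k))).
rewrite [RHS]big_ltn //.
(* The sum in [binet] starts at k = 1; the extra term k = 0 is a multiple of the moment of 1. *)
have -> : moment ((rising R m)`_0 *: ('X + a%:P) ^+ 0) = 0.
  by rewrite linearZ /= expr0 -(expr0 'X) moment_Xn mulr0 mul0r mulr0.
rewrite add0r.
apply: eq_big_nat => k _; rewrite [RHS]linearZ [RHS]/= moment_XaddC_exp.
rewrite coef_rising -mulrA [LHS]mulrC; congr (_ * _ * _).
rewrite expfzDr ?oppr_eq0 ?oner_eq0 // -exprnN -!exprnP -signr_odd.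
by rewrite invr_sign signr_odd mulrC exprD.
Qed.

(** The normalised derivative already carries the factor 1/j!. *)
Definition binet_coef m j : R := m%:R^-1 * moment (rising R m)^`N(j).

Definition binet_poly m : {poly R} := \poly_(j < m) binet_coef m j.

Lemma hornerE_binet_poly m (a : R) : (0 < m)%N -> binet m a = (binet_poly m).[a].
Proof.
move=> m0; rewrite binet_moment // comp_XaddC_taylor size_rising linear_sum.
rewrite big_ord_recr /= linearZ /=.
(* The Taylor expansion has m + 1 terms, but the last derivative is a constant. *)
have -> : moment (rising R m)^`N(m) = 0.
  rewrite (@moment_sum _ 1) ?big_ord1 ?moment_Xn ?mulr0 ?mul0r ?mulr0 //.
  by apply/leq_sizeP => i i0; rewrite coef_nderivn nth_default ?mul0rn //
    size_rising -addn1 leq_add2l.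
rewrite mulr0 addr0 horner_poly mulr_sumr.
by apply: eq_bigr => i _; rewrite linearZ /= /binet_coef; ring.
Qed.

(** Put k = j + i for the term of degree i. The binomial C(k, j) from the derivative times the
    moment of X^i gives, up to sign, k! (k - j) / (2 j! (k + 2 - j)!). *)
Lemma binet_coefE m j : (0 < m)%N -> (j < m)%N ->
  binet_coef m j = (-1) ^+ (m - 1 - j) / (2 * m%:R * (j`!)%:R)
    * \sum_(j.+1 <= k < m.+1)
        ((k`!)%:R * (k - j)%:R / ((k + 2 - j)`!)%:R * (stirling1 m k)%:~R).
Proof.
move=> m0 jm; rewrite /binet_coef (@moment_sum _ (m - j).+1); last first.
  apply/leq_sizeP => i ij; rewrite coef_nderivn nth_default ?mul0rn //.
  by rewrite size_rising; lia.
(* The constant term k = j drops out; from here on k = j + i + 1. *)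
rewrite big_ord_recl moment_Xn mulr0 mul0r mulr0 add0r.
rewrite -[in RHS](add0n j.+1) big_addn big_mkord subSS.
rewrite !mulr_sumr; apply: eq_bigr => i _; rewrite lift0.
rewrite coef_nderivn coef_rising moment_Xn.
have -> : (i + j.+1 - j)%N = i.+1 by lia.
have -> : (i + j.+1 + 2 - j)%N = i.+3 by lia.
have -> : (i + j.+1 = (j + i).+1)%N by lia.
rewrite [(j + i.+1)%N]addnS; set n := (j + i).+1; set S := (stirling1 m n)%:~R.
have -> : (-1) ^+ (m - 1 - j) = (-1) ^+ (m + n) * (-1) ^+ i.+2 :> R.
  rewrite -exprD -signr_odd -[RHS]signr_odd; congr (_ ^+ _).
  have -> : (m + n + i.+2 = (m - 1 - j) + (j + i).+2.*2)%N by rewrite /n; lia.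
  by rewrite oddD odd_double addbF.
have fact_n : ('C(n, j))%:R * ((j`!)%:R * (i.+1`!)%:R) = (n`!)%:R :> R.
  rewrite -!natrM; have -> : i.+1 = (n - j)%N by rewrite /n; lia.
  by rewrite bin_fact // /n; lia.
rewrite -[_ *+ 'C(n, j)]mulr_natr -fact_n !factS !natrM.
have f0 k : (k`!)%:R != 0 :> R by rewrite pnatr_eq0 -lt0n fact_gt0.
have n0 k : k.+1%:R != 0 :> R by rewrite pnatr_eq0.
have m0' : m%:R != 0 :> R by rewrite pnatr_eq0 -lt0n.
move: (f0 j) (f0 i) (n0 i) (n0 i.+1) (n0 i.+2) m0'.
(* With the factorials expanded, the identity holds for arbitrary nonzero values of the
   denominators. *)
move: (j`!)%:R (i`!)%:R i.+1%:R i.+2%:R i.+3%:R m%:R ('C(n, j))%:R.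
move: ((-1) ^+ (m + n)) ((-1) ^+ i.+2) S.
move=> e e' S' x y z t w v C x0 y0 z0 t0 w0 v0.
by field; rewrite x0 y0 z0 t0 w0 v0.
Qed.

Lemma binet_coef_top m : binet_coef m.+1 m = 1 / 12.
Proof.
rewrite binet_coefE // subn1 subnn expr0 big_nat1 stirling1_diag.
have -> : (m.+1 - m = 1)%N by lia.
have -> : (m.+1 + 2 - m = 3)%N by lia.
have f0 : (m`!)%:R != 0 :> R by rewrite pnatr_eq0 -lt0n fact_gt0.
have n0 : m.+1%:R != 0 :> R by rewrite pnatr_eq0.
rewrite factS natrM (_ : 3`! = 6)%N //.
move: (m`!)%:R m.+1%:R f0 n0 => x y x0 y0.
by field; rewrite x0 y0.
Qed.

(** Only k = m + 1 and k = m + 2 contribute, giving (m + 1)^2 / 24 - (m + 1) / 24 = m (m + 1) /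
    24. *)
Lemma binet_coef_subtop m : binet_coef m.+2 m = 1 / 12 * ('C(m.+1, 2))%:R.
Proof.
rewrite binet_coefE // big_nat_recr // big_nat1 /=.
rewrite stirling1_diag stirling1_subdiag.
have -> : (m.+2 - 1 - m = 1)%N by lia.
have -> : (m.+1 + 2 - m = 3)%N by lia.
have -> : (m.+2 - m = 2)%N by lia.
have -> : (m.+2 + 2 - m = 4)%N by lia.
have f0 : (m`!)%:R != 0 :> R by rewrite pnatr_eq0 -lt0n fact_gt0.
have n2 : m.+2%:R != 0 :> R by rewrite pnatr_eq0.
have binE k : 2 * ('C(k.+1, 2))%:R = k.+1%:R * k%:R :> R.
  by rewrite -!natrM -(mul_bin_diag k.+1 1) bin1.
have {}binE k : ('C(k.+1, 2))%:R = k.+1%:R * k%:R / 2 :> R.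
  by rewrite -binE mulrC mulKf // pnatr_eq0.
rewrite (_ : 3`! = 6)%N // (_ : 4`! = 24)%N // !factS !natrM.
rewrite rmorphN /= -pmulrn !binE.
have e1 : m.+1%:R = m%:R + 1 :> R by rewrite natr1.
have e2 : m.+2%:R = m%:R + 2 :> R by rewrite -natrD addn2.
move: n2; rewrite e1 e2.
move: (m`!)%:R m%:R f0 => x y x0 y2.
by field; rewrite x0 y2.
Qed.

End Analysis.

Theorem mainTheorem4 (R : realType) (m : nat) (hm : (1 <= m)%N) :
  exists p : {poly R},
    [/\ (forall alpha : R, binet m alpha = p.[alpha]),
        size p = m,
        (forall alpha : R, binet m alpha = \sum_(j < m) p`_j * alpha ^+ j),
        (forall j : nat, (j <= m - 1)%N ->
           [/\ p`_j = (j`!)%:R^-1 * derive1n j (@binet R m) 0,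
               p`_j = (-1) ^+ (m - 1 - j) / (2 * m%:R * (j`!)%:R)
                      * \sum_(j.+1 <= k < m.+1)
                          ((k`!)%:R * (k - j)%:R / ((k + 2 - j)`!)%:R
                           * (stirling1 m k)%:~R)
             & p`_j = (m%:R * (j`!)%:R)^-1
                      * \int[@lebesgue_measure R]_(u in `[(-1 : R), (0 : R)]%classic)
                          ((u + 1 / 2)
                           * derive1n j
                               (fun v : R => \prod_(k < m) (k%:R + v)) u)])
      & p`_(m - 1) = 1 / 12
        /\ ((2 <= m)%N -> p`_(m - 2) = 1 / 12 * ('C(m - 1, 2))%:R)].
Proof.
have coefE j : (j < m)%N -> (binet_poly R m)`_j = binet_coef R m j.
  by move=> jm; rewrite coef_poly jm.
have f0 k : (k`!)%:R != 0 :> R by rewrite pnatr_eq0 -lt0n fact_gt0.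
exists (binet_poly R m); split.
- by move=> a; exact: hornerE_binet_poly.
(* The degree is exactly m - 1 because the top coefficient 1/12 is nonzero. *)
- case: m hm coefE => // m _ _; apply: size_poly_eq.
  by rewrite binet_coef_top mul1r invr_eq0 pnatr_eq0.
- by move=> a; rewrite hornerE_binet_poly // -horner_poly /binet_poly;
    congr horner; apply/polyP => i; rewrite !coef_poly; case: ifP.
- move=> j jm1; have jm : (j < m)%N by lia.
  split.
  + have -> : @binet R m = horner (binet_poly R m).
      by apply/funext => a; exact: hornerE_binet_poly.
    rewrite derive1n_horner horner_coef0 coef_derivn addn0 ffactnn.
    by rewrite -[X in _ * X]mulr_natl mulKf.
  + by rewrite coefE // binet_coefE.
  + have -> : (fun v : R => \prod_(k < m) (k%:R + v)) = horner (rising R m).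
      apply/funext => v; rewrite /rising horner_prod.
      by apply: eq_bigr => k _; rewrite hornerD hornerX hornerC addrC.
    (* The ordinary derivative is j! times the normalised one, which accounts for the j! in the
       denominator. *)
    rewrite derive1n_horner Rintegral_moment coefE // nderivn_def.
    by rewrite raddfMn /= -[X in _ * X]mulr_natl invfM -mulrA mulKf.
- case: m hm coefE => // m _ coefE; split.
    by rewrite subn1 coefE // binet_coef_top.
  case: m coefE => // m coefE _.
  by rewrite subn2 subn1 coefE // binet_coef_subtop.
Qed.
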